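(* Let $(\mathbb{R}^n,\|\cdot\|)$ be a Minkowski space. The following are equivalent: (i) The norm $\|\cdot\|$ is strictly convex. (vi) Every b-convex body that is not b-bounded is a closed ball of radius $1$. (vii) Every b-convex body that is not b-bounded has only one supporting sphere. (viii) For every boundary point $x$ of a b-convex body $K$ that is not b-bounded, there exists only one supporting sphere of $K$ that contains $x$. (ix) For every $x \in \mathbb{R}^n$, every $r \in (0,1)$ and every $x_0 \in \operatorname{bd}(B(x,r))$, $B(x,r)$ has only one supporting sphere that contains $x_0$. (x) There exist $x \in \mathbb{R}^n$ and $r \in (0,1)$ such that, for every $x_0 \in \operatorname{bd}(B(x,r))$, $B(x,r)$ has only one supporting sphere that contains $x_0$. (xi) For every $x \in \mathbb{R}^n$ and every $r \in (0,1)$, each supporting sphere of $B(x,r)$ meets $B(x,r)$ in only one point. (xii) There exist $x \in \mathbb{R}^n$ and $r \in (0,1)$ such that each supporting sphere of $B(x,r)$ meets $B(x,r)$ in only one point. (xiii) For every $x \in \mathbb{R}^n$ and every $r \in (0,1)$, $\operatorname{b-exp}(B(x,r))=S(x,r)$. (xiv) There exist $x \in \mathbb{R}^n$ and $r \in (0,1)$ such that $\operatorname{b-exp}(B(x,r))=S(x,r)$. (xv) Every b-convex body is strictly convex. (xvi) For any two distinct points $x_1,x_2 \in \mathbb{R}^n$, $\operatorname{bh}_1(\{x_1,x_2\})$ is strictly convex. (xvii) Every b-convex body that contains at least two points has non-empty interior. (xviii) For any two distinct points $x_1,x_2 \in \mathbb{R}^n$, $\operatorname{int}(\operatorname{bh}_1(\{x_1,x_2\}))$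 is non-empty.
   Context: A Minkowski space $(\mathbb{R}^n,\|\cdot\|)$ is $\mathbb{R}^n$, $n\ge 1$, equipped with an arbitrary norm. For $x\in\mathbb{R}^n$ and $r\ge 0$, $B(x,r)=\{y:\|y-x\|\le r\}$ is the closed ball and $S(x,r)=\{y:\|y-x\|=r\}$ the sphere; $\operatorname{int}$ and $\operatorname{bd}$ denote interior and boundary. A closed convex set is strictly convex if its boundary contains no segment $[x_1,x_2]$ with $x_1\ne x_2$ (so singletons are strictly convex and, having empty boundary, so is $\mathbb{R}^n$); the norm $\|\cdot\|$ is strictly convex if its unit ball $B(o,1)$ ($o$ the origin) is strictly convex. The ball hull of $S\subseteq\mathbb{R}^n$ is $\operatorname{bh}_1(S)=\bigcap_{x\in\mathbb{R}^n:\,S\subseteq B(x,1)}B(x,1)$, where the intersection of an empty family is $\mathbb{R}^n$. A set $S$ is b-convex if $S=\operatorname{bh}_1(S)$; a b-convex body is a bounded non-empty b-convex set. (Every ball $B(x,r)$ with $r\in[0,1]$ is a b-convex body.) A supporting sphere of a b-convex body $K$ is a sphere $S(x,1)$ of radius $1$ with $K\subseteq B(x,1)$ and $K\cap S(x,1)\neq\emptyset$; the set $K\cap S(x,1)$ is then called an exposed b-face of $K$. If an exposed b-face is a singleton $\{x_0\}$, then $x_0$ is a b-exposed point of $K$; $\operatorname{b-exp}(K)$ is the set of all b-exposed points of $K$. The circumradius $\operatorname{rad}(S)$ is the least $r\ge 0$ such that $S$ is contained in some ball $B(x,r)$ (and $+\infty$ if $S$ is unbounded). A set $S$ is b-bounded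 if $\operatorname{rad}(S)<1$. *)

(* Defs.v *)
From HB Require Import structures.
From mathcomp Require Export all_boot all_order all_algebra.
From mathcomp Require Export all_classical all_reals all_analysis.

Set Implicit Arguments.
Unset Strict Implicit.
Unset Printing Implicit Defensive.

Export Order.TTheory GRing.Theory Num.Theory.
Export numFieldNormedType.Exports.

Local Open Scope classical_set_scope.
Local Open Scope ring_scope.

(* R^n is 'rV[R]_n with the library's (product) topology, which is also the
   topology of every norm on R^n; the norm of the Minkowski space is an
   explicit function N, unrelated to the max norm `|x| carried by 'rV[R]_n.
   B(x, r) is the library's closed_ball_ N x r = [set y | N (x - y) <= r]. *)

(* N 0 = 0 and 0 <= N x follow from these axioms. *)
Record is_norm (R : realType) (n : nat) (N : 'rV[R]_n -> R) : Prop := IsNorm {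
  is_norm_triangle : forall x y, N (x + y) <= N x + N y;
  is_norm_scale : forall (a : R) x, N (a *: x) = `|a| * N x;
  is_norm_definite : forall x, N x = 0 -> x = 0 }.

Definition boundary (T : topologicalType) (A : set T) : set T :=
  closure A `\` A°.

Definition segment (R : realType) (n : nat) (x1 x2 : 'rV[R]_n) :
    set 'rV[R]_n :=
  [set (1 - t) *: x1 + t *: x2 | t in `[0%R, 1%R]].

Definition strictly_convex_set (R : realType) (n : nat) (A : set 'rV[R]_n) :
    Prop :=
  [/\ closed A, convex_set (M := 'rV[R]_n) A &
      forall x1 x2, x1 != x2 -> ~ (segment x1 x2 `<=` boundary A)].

Section Minkowski.
Context (R : realType) (n : nat) (N : 'rV[R]_n -> R).
Implicit Types (S K F T : set 'rV[R]_n) (x : 'rV[R]_n) (r : R).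

Definition msphere x r : set 'rV[R]_n := [set y | N (x - y) = r].

Definition strictly_convex_norm : Prop :=
  strictly_convex_set (closed_ball_ N 0 1).

Definition ball_hull S : set 'rV[R]_n :=
  \bigcap_(x in [set x | S `<=` closed_ball_ N x 1]) closed_ball_ N x 1.

Definition b_convex S : Prop := S = ball_hull S.

Definition mbounded S : Prop := exists M : R, S `<=` closed_ball_ N 0 M.

Definition b_convex_body K : Prop := [/\ b_convex K, K !=set0 & mbounded K].

(* For a bounded set the infimum is attained, by compactness; for an unbounded
   one it is the infimum of the empty set, +oo. *)
Definition circumradius S : \bar R :=
  ereal_inf [set r%:E | r in
    [set r : R | 0 <= r /\ exists x, S `<=` closed_ball_ N x r]].

Definition b_bounded S : Prop := (circumradius S < 1)%E.

Definition supporting_sphere K T : Prop :=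
  exists x, [/\ T = msphere x 1, K `<=` closed_ball_ N x 1 & K `&` T !=set0].

Definition exposed_b_face K F : Prop :=
  exists2 T, supporting_sphere K T & F = K `&` T.

Definition b_exp K : set 'rV[R]_n := [set x0 | exposed_b_face K [set x0]].

End Minkowski.

(* Main.v *)
Require Import Defs.
From mathcomp Require Import ring lra.

Set Implicit Arguments.
Unset Strict Implicit.
Unset Printing Implicit Defensive.

Local Open Scope classical_set_scope.
Local Open Scope ring_scope.

Local Ltac row_ring := by
  apply/rowP => ?; rewrite !mxE; field; do ?[apply/andP; split].

(** The statements all express one property of the norm, used here in the
form [rotund]: a unit vector [m] is never the midpoint of a nondegenerate
segment of the unit ball, from [m - d] to [m + d].  By convexity such a
segment would lie entirely in the unit sphere ([flat_segment]), so this is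
strict convexity of the norm ([strictly_convex_normP]).

From [rotund] to the other statements, two principles are at work.  First, if
a family of unit balls has a bounded closed set of centers, a point at distance
less than [1] from every center is at distance at most some [r < 1] from all of
them ([uniform_strict_dist]); this is where compactness, hence the equivalence
of all norms on R^n, enters.  If [K] lies in two distinct unit balls, each of
its points is at distance less than [1] from the midpoint of the centers, so
[K] lies in a smaller ball: a b-convex body of circumradius [1] therefore has
one center and is a unit ball.  Dually, if [p <> q] are in a b-convex set, their
midpoint is at distance less than [1] from all the centers of the unit balls
around the set, hence is an interior point; this yields strict convexity of
all b-convex sets and nonempty interiors.  Second, [B(x, r)] lies in [B(y, 1)]
exactly when [N (y - x) <= 1 - r], so a common point [p] of [B(x, r)] and of a
supporting sphere [S(y, 1)] realizes equality in the triangle inequality along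
[p], [x], [y]; rotundity forces [p], [x], [y] to be aligned, and [p] and [y]
determine each other.

Conversely, let the segment from [m - d] to [m + d] be in the unit sphere.  The
intersection of the unit balls with centers [d] and [- d] contains [m] and
[- m], so it has circumradius [1], and [m] is on two of its supporting spheres.
In [B(x, r)] the points [x - r *: (m + t *: d)] all lie on all the supporting
spheres with centers [x + (1 - r) *: (m + s *: d)].  The ball hull of
[m - d] and [m + d] is in the unit balls with centers [0] and [2 *: m], whose
intersection is a piece of hyperplane: its interior is empty, and the segment
is on its boundary. *)

Section NormTheory.
Context (R : realType) (n : nat) (N : 'rV[R]_n -> R) (N_norm : is_norm N).
Implicit Types (A K S T : set 'rV[R]_n) (x y z p q u v : 'rV[R]_n) (r t : R).

Let norm_triangle x y : N (x + y) <= N x + N y.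
Proof. exact: (is_norm_triangle N_norm). Qed.

(** * Algebra of an arbitrary norm *)

Lemma norm0 : N 0 = 0.
Proof. by rewrite -(scale0r 0) (is_norm_scale N_norm) normr0 mul0r. Qed.

Lemma normN x : N (- x) = N x.
Proof. by rewrite -scaleN1r (is_norm_scale N_norm) normrN1 mul1r. Qed.

Lemma norm_ge0 x : 0 <= N x.
Proof. by have := norm_triangle x (- x); rewrite subrr norm0 normN; lra. Qed.

Lemma norm_eq0 x : (N x == 0) = (x == 0).
Proof.
by apply/eqP/eqP => [/(is_norm_definite N_norm)//|->]; exact: norm0.
Qed.

Lemma normZ_ge0 t x : 0 <= t -> N (t *: x) = t * N x.
Proof. by move=> t0; rewrite (is_norm_scale N_norm) ger0_norm. Qed.

Lemma normBC x y : N (x - y) = N (y - x).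
Proof. by rewrite -normN opprB. Qed.

Lemma normB_triangle y x z : N (x - z) <= N (x - y) + N (y - z).
Proof.
have -> : x - z = (x - y) + (y - z) by rewrite addrA subrK.
exact: norm_triangle.
Qed.

Lemma dist_conv x p q t : 0 <= t <= 1 ->
  N (x - ((1 - t) *: p + t *: q)) <= (1 - t) * N (x - p) + t * N (x - q).
Proof.
move=> /andP[t0 t1].
have -> : x - ((1 - t) *: p + t *: q) = (1 - t) *: (x - p) + t *: (x - q).
  by row_ring.
by rewrite -!normZ_ge0 ?subr_ge0//; exact: norm_triangle.
Qed.

Lemma closed_ball_self x r : 0 <= r -> closed_ball_ N x r x.
Proof. by rewrite /closed_ball_ /= subrr norm0. Qed.

Section Nontrivial.
Context (n_gt0 : (0 < n)%N).

Lemma unit_direction z : exists2 u, N u = 1 & z = N z *: u.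
Proof.
suff {z} H z : z != 0 -> exists2 u, N u = 1 & z = N z *: u.
  have [->|/H//] := eqVneq z 0.
  have /H[u u1 _] : const_mx 1 != 0 :> 'rV[R]_n.
    apply/eqP => /rowP /(_ (Ordinal n_gt0)); rewrite !mxE => /eqP.
    by rewrite oner_eq0.
  by exists u; rewrite // norm0 scale0r.
rewrite -norm_eq0 => z0; exists ((N z)^-1 *: z).
  by rewrite normZ_ge0 ?invr_ge0 ?norm_ge0// mulVf.
by rewrite scalerA divff// scale1r.
Qed.

(** The point of the sphere diametrically opposite to [y] realizes equality in
the triangle inequality. *)
Lemma far_point x y r : 0 <= r ->
  exists2 p, N (x - p) = r & N (y - p) = N (y - x) + r.
Proof.
move=> r0; have [u u1 yxE] := unit_direction (y - x).
exists (x - r *: u).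
  by rewrite opprB addrCA subrr addr0 normZ_ge0// u1 mulr1.
have -> : y - (x - r *: u) = (N (y - x) + r) *: u.
  by rewrite scalerDl -yxE opprB addrA addrAC.
by rewrite normZ_ge0 ?addr_ge0 ?norm_ge0// u1 mulr1.
Qed.

Lemma sub_closed_ball x y r s : 0 <= r ->
  closed_ball_ N x r `<=` closed_ball_ N y s <-> N (y - x) + r <= s.
Proof.
move=> r0; split=> [xy|yx p /= xp].
  by have [p xp <-] := far_point x y r0; apply: xy; rewrite /closed_ball_ /= xp.
by apply: le_trans yx; apply: le_trans (normB_triangle x _ _) _; rewrite lerD2l.
Qed.

Lemma msphere_inj x y r : 0 <= r -> msphere N x r = msphere N y r -> x = y.
Proof.
move=> r0 xyE; have [p xp yp] := far_point x y r0.
have : msphere N y r p by rewrite -xyE.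
rewrite /msphere /= yp => /eqP; rewrite -subr_eq0 addrK norm_eq0 subr_eq0.
by move/eqP.
Qed.

End Nontrivial.

(** * Topology of an arbitrary norm *)

(** With [mx_norm_le_norm], the equivalence of [N] with the max norm, which
carries the topology. *)
Lemma norm_le_mx_norm : exists2 C, 0 < C & forall x, N x <= C * `|x|.
Proof.
exists (1 + \sum_(j < n) N (delta_mx 0 j)) => [|x].
  by rewrite ltr_pwDl// sumr_ge0// => j _; exact: norm_ge0.
rewrite mulrDl mul1r ler_wpDl// {1}(row_sum_delta x) mulr_suml.
elim/big_ind2 : _ => [|a b c d ab cd|j _]; first by rewrite norm0.
  by apply: le_trans (norm_triangle _ _) _; exact: lerD.
rewrite (is_norm_scale N_norm) mulrC ler_wpM2l ?norm_ge0//.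
rewrite -[`|x|]/(mx_norm x) mx_normrE; apply/bigmax_geP; right.
by exists (ord0, j).
Qed.

Lemma continuous_dist x : continuous (fun y => N (x - y)).
Proof.
have [C C0 NC] := norm_le_mx_norm.
move=> y; apply/(@cvgrPdist_le _ _ _ _ (nbhs_filter y)) => e e0.
apply/nbhs_ballP; exists (e / C) => [|z]; first exact: divr_gt0.
rewrite -ball_normE /= ltr_pdivlMr// mulrC => yzC.
have := normB_triangle y x z; have := normB_triangle z x y.
by rewrite (normBC z y) ler_norml; have := NC (y - z); lra.
Qed.

Lemma closed_mball x r : closed (closed_ball_ N x r).
Proof.
rewrite (_ : closed_ball_ N x r =
    (N \o (fun y => x - y)) @^-1` [set t | t <= r])//.
by apply: closed_comp => [y _|]; [exact: continuous_dist|exact: closed_le].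
Qed.

(** [N] attains a positive minimum on the unit sphere of the max norm, which is
compact; that sphere is empty only for the trivial space. *)
Lemma mx_norm_le_norm : exists2 c, 0 < c & forall x, c * `|x| <= N x.
Proof.
have [[u u1]|no1] := pselect (exists u : 'rV[R]_n, `|u| = 1); last first.
  exists 1 => // x; have [->|x0] := eqVneq x 0.
    by rewrite normr0 mulr0 norm0.
  case: no1; exists (`|x|^-1 *: x).
  by rewrite normrZ normfV normr_id mulVf// normr_eq0.
pose A : set 'rV[R]_n := [set x | `|x| = 1].
have cA : compact A.
  apply: bounded_closed_compact.
    exists 1; split=> // M M1 x; rewrite /A /= => ->; exact: ltW.
  rewrite (_ : A = (fun x => `|x|) @^-1` [set 1])//.
  by apply: closed_comp => [y _|]; [exact: norm_continuous|exact: closed_eq].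
have [||c] := compact_EVT_min (f := fun y => N (0 - y)) _ cA; first by exists u.
  by apply: continuous_subspaceT; exact: continuous_dist.
rewrite inE /A /= => c1 Nc; exists (N c) => [|x].
  rewrite lt_neqAle eq_sym norm_eq0 norm_ge0 andbT -normr_eq0 c1.
  exact: oner_neq0.
have [->|x0] := eqVneq x 0; first by rewrite normr0 mulr0 norm0.
have x_gt0 : 0 < `|x| by rewrite normr_gt0.
have := Nc (`|x|^-1 *: x); rewrite inE /A /= normrZ normfV normr_id.
rewrite mulVf ?gt_eqF// !sub0r !normN => /(_ erefl).
by rewrite normZ_ge0 ?invr_ge0 ?(ltW x_gt0)// mulrC ler_pdivlMr.
Qed.

Lemma mbounded_closed_compact A : mbounded N A -> closed A -> compact A.
Proof.
move=> [M AM] Acl; have [c c0 cN] := mx_norm_le_norm.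
apply: bounded_closed_compact => //; exists (M / c).
split; first exact: num_real.
move=> r Mr x /AM; rewrite /closed_ball_ /= sub0r normN => xM.
apply: le_trans (ltW Mr); rewrite ler_pdivlMr// mulrC; exact: le_trans xM.
Qed.

(** Compactness turns a pointwise strict bound into a uniform one: the distance
to [x] attains its maximum on [A].  The radius [0] covers the empty set. *)
Lemma uniform_strict_dist A x : closed A -> mbounded N A ->
  (forall y, A y -> N (x - y) < 1) ->
  exists r, [/\ 0 <= r, r < 1 & A `<=` closed_ball_ N x r].
Proof.
move=> Acl Ab A1.
have [[a Aa]|A0] := pselect (A !=set0); last first.
  by exists 0; split=> // y Ay; case: A0; exists y.
have [||b] := compact_EVT_max (f := fun y => N (x - y)) _
  (mbounded_closed_compact Ab Acl).
- by exists a.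
- by apply: continuous_subspaceT; exact: continuous_dist.
rewrite inE => bA bmax.
exists (N (x - b)); split; [exact: norm_ge0|exact: A1|].
by move=> y Ay; apply: bmax; rewrite inE.
Qed.

(** As [N] is equivalent to the max norm, the interior can be tested with balls
of [N]. *)
Lemma interior_ballP A p :
  A° p <-> exists2 e, 0 < e & closed_ball_ N p e `<=` A.
Proof.
split=> [|[e e0 peA]].
  rewrite /interior /= -nbhs_ballE => -[d /= d0 pdA].
  have [c c0 cN] := mx_norm_le_norm.
  exists (c * (d / 2)) => [|y]; first by rewrite mulr_gt0// divr_gt0.
  rewrite /closed_ball_ /= => py; apply: pdA; rewrite -ball_normE /=.
  by have := le_trans (cN _) py; rewrite ler_pM2l//; lra.
rewrite /interior /=; have := @continuous_dist p p.
rewrite /continuous_at subrr norm0 => /cvgrPdist_le /(_ _ e0).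
apply: filterS => y; rewrite sub0r normrN ger0_norm ?norm_ge0//; exact: peA.
Qed.

Lemma interior_mball x r p : 0 < r ->
  (closed_ball_ N x r)° p <-> N (x - p) < r.
Proof.
move=> r0; split=> [/interior_ballP[e e0 pe]|xp]; last first.
  apply/interior_ballP; exists (r - N (x - p)); first by rewrite subr_gt0.
  move=> y; rewrite /closed_ball_ /= => py.
  by have := normB_triangle p x y; lra.
have [xp0|xp0] := eqVneq (N (x - p)) 0; first by rewrite xp0.
have xp_gt0 : 0 < N (x - p) by rewrite lt_neqAle eq_sym xp0 norm_ge0.
(* Moving from [p] away from [x] by [e] stays in the ball. *)
pose a := e / N (x - p).
have a0 : 0 < a by exact: divr_gt0.
have := pe (p - a *: (x - p)); rewrite /closed_ball_ /=.
have -> : p - (p - a *: (x - p)) = a *: (x - p) by row_ring.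
have -> : x - (p - a *: (x - p)) = (1 + a) *: (x - p) by row_ring.
rewrite !normZ_ge0 ?addr_ge0 ?(ltW a0)// [X in X <= e]divfK// lexx.
by move=> /(_ isT); apply: lt_le_trans; rewrite ltr_pMl// ltrDl.
Qed.

Lemma boundary_mball x r : 0 < r ->
  boundary (closed_ball_ N x r) = msphere N x r.
Proof.
move=> r0; rewrite /boundary -(closure_id _).1; last exact: closed_mball.
apply/seteqP; split=> p; rewrite /setD /msphere /= interior_mball//.
  by move=> [xp /negP]; rewrite -leNgt => rx; apply/eqP; rewrite eq_le rx andbT.
by move=> xp; rewrite /closed_ball_ /= xp lexx ltxx.
Qed.

Lemma mball_conv x r p q t : 0 <= t <= 1 ->
  closed_ball_ N x r p -> closed_ball_ N x r q ->
  closed_ball_ N x r ((1 - t) *: p + t *: q).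
Proof.
move=> t01; rewrite /closed_ball_ /= => xp xq.
apply: le_trans (dist_conv _ _ _ t01) _; case/andP: t01 => t0 t1.
have -> : r = (1 - t) * r + t * r by ring.
by rewrite lerD// ler_wpM2l// subr_ge0.
Qed.

(** The library states convexity with bundled weights in the unit interval. *)
Lemma convex_set_segment A :
  (forall p q t, 0 <= t <= 1 -> A p -> A q -> A ((1 - t) *: p + t *: q)) ->
  convex_set (M := 'rV[R]_n) A.
Proof.
move=> cA p q t; rewrite !inE => Ap Aq.
have -> : conv t p q = (1 - (1 - t%:num)) *: p + (1 - t%:num) *: q :> 'rV[R]_n.
  by rewrite opprB addrCA subrr addr0.
by apply: cA => //; rewrite subr_ge0 lerBlDr lerDl le1 ge0.
Qed.

(** * Ball hulls *)

Lemma ball_hull_conv S p q t : 0 <= t <= 1 ->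
  ball_hull N S p -> ball_hull N S q -> ball_hull N S ((1 - t) *: p + t *: q).
Proof.
by move=> t01 Sp Sq x Sx; apply: mball_conv => //; [exact: Sp|exact: Sq].
Qed.

Lemma convex_ball_hull S : convex_set (M := 'rV[R]_n) (ball_hull N S).
Proof. by apply: convex_set_segment => p q t; exact: ball_hull_conv. Qed.

Lemma closed_ball_hull S : closed (ball_hull N S).
Proof. by apply: closed_bigI => x _; exact: closed_mball. Qed.

Lemma sub_ball_hull S : S `<=` ball_hull N S.
Proof. by move=> p Sp x; exact. Qed.

Lemma ball_hull_sub S x :
  S `<=` closed_ball_ N x 1 -> ball_hull N S `<=` closed_ball_ N x 1.
Proof. by move=> Sx p; exact. Qed.

Lemma b_convex_ball_hull S : b_convex N (ball_hull N S).
Proof.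
apply/seteqP; split; first exact: sub_ball_hull.
by move=> p Sp x Sx; apply: Sp => /=; exact: ball_hull_sub.
Qed.

Lemma mball_mbounded x r : mbounded N (closed_ball_ N x r).
Proof.
exists (N x + r) => p; rewrite /closed_ball_ /= => xp.
by have := normB_triangle x 0 p; rewrite !sub0r !normN; lra.
Qed.

Lemma sub_mbounded S T : S `<=` T -> mbounded N T -> mbounded N S.
Proof. by move=> ST [M TM]; exists M => p /ST/TM. Qed.

Lemma b_convex_bigI (C : set 'rV[R]_n) :
  b_convex N (\bigcap_(x in C) closed_ball_ N x 1).
Proof.
apply/seteqP; split; first exact: sub_ball_hull.
by move=> p Cp x Cx; apply: Cp => q Cq; exact: Cq.
Qed.

Lemma b_boundedP K :
  b_bounded N K <-> exists x r, [/\ 0 <= r, r < 1 & K `<=` closed_ball_ N x r].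
Proof.
split=> [/ereal_inf_lt[_ [r [r0 [x Kx]] <-]]|[x [r [r0 r1 Kx]]]].
  by rewrite lte_fin => r1; exists x, r.
apply: le_lt_trans (ereal_inf_lbound _) _.
  by exists r; [split; [|exists x]|].
by rewrite lte_fin.
Qed.

Definition centers K : set 'rV[R]_n := [set x | K `<=` closed_ball_ N x 1].

(** Being a center is symmetric in the two points, so the set of centers is
itself an intersection of unit balls. *)
Lemma closed_centers K : closed (centers K).
Proof.
have -> : centers K = \bigcap_(p in K) closed_ball_ N p 1.
  apply/seteqP; split=> x Kx p Kp; rewrite /closed_ball_ /= normBC.
    exact: Kx.
  exact: Kx.
by apply: closed_bigI => p _; exact: closed_mball.
Qed.

Lemma mbounded_centers K : K !=set0 -> mbounded N (centers K).
Proof.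
move=> [p Kp]; apply: sub_mbounded (mball_mbounded p 1) => x Kx.
by rewrite /closed_ball_ /= normBC; exact: Kx.
Qed.

(** Otherwise the hull would be an empty intersection, the whole unbounded
space. *)
Lemma centers_nonempty K : (0 < n)%N -> b_convex N K -> mbounded N K ->
  centers K !=set0.
Proof.
move=> n0 Kb [M KM]; apply: contrapT => C0.
have M0 : 0 <= `|M| + 1 by rewrite addr_ge0.
have [p pM _] := far_point n0 0 0 M0.
have /KM : K p by rewrite Kb => x Kx; case: C0; exists x.
by rewrite /closed_ball_ /= pM; have := ler_norm M; lra.
Qed.

Lemma b_convex_closed K : b_convex N K -> closed K.
Proof. by move=> ->; exact: closed_ball_hull. Qed.

Lemma b_convex_center_unique K x : b_convex N K -> centers K x ->
  (forall y, centers K y -> y = x) -> K = closed_ball_ N x 1.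
Proof.
move=> Kb Kx xuniq; apply/seteqP; split=> // p xp.
by rewrite Kb => y /xuniq ->.
Qed.

(** A unit ball around [K] whose sphere misses [K] could be shrunk, making [K]
b-bounded. *)
Lemma supporting_sphere_unbounded K x : b_convex N K -> mbounded N K ->
  ~ b_bounded N K -> centers K x -> supporting_sphere N K (msphere N x 1).
Proof.
move=> Kb Km Knb Kx; exists x; split=> //; apply: contrapT => K0; apply: Knb.
apply/b_boundedP; exists x; apply: uniform_strict_dist => //.
  exact: b_convex_closed.
move=> p Kp; rewrite lt_neqAle Kx// andbT; apply/eqP => xp.
by apply: K0; exists p.
Qed.

Lemma supporting_sphere_mball x r T : (0 < n)%N -> 0 <= r ->
  supporting_sphere N (closed_ball_ N x r) T <->
  exists y, [/\ T = msphere N y 1, N (y - x) <= 1 - r &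
    closed_ball_ N x r `&` T !=set0].
Proof.
move=> n0 r0; split=> -[y [-> yx yT]]; exists y; split=> //.
  by have /(sub_closed_ball n0 _ _ _ r0) := yx; lra.
by apply/(sub_closed_ball n0 _ _ _ r0); lra.
Qed.

(** The center of the unit ball that contains [B(x, r)] and is internally
tangent to it at [p]: the image of [p] by the homothety with center [x] and
ratio [- (1 - r) / r]. *)
Definition tangent_center x r p := x + ((1 - r) / r) *: (x - p).

Lemma tangent_sphere x r p : (0 < n)%N -> 0 < r < 1 -> msphere N x r p ->
  supporting_sphere N (closed_ball_ N x r)
    (msphere N (tangent_center x r p) 1) /\
  msphere N (tangent_center x r p) 1 p.
Proof.
rewrite /msphere /tangent_center /= => n0 /andP[r0 r1] xp.
have rn0 : r != 0 by rewrite gt_eqF.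
have c0 : 0 <= (1 - r) / r by rewrite divr_ge0 ?subr_ge0 ?ltW.
have yp : N (x + ((1 - r) / r) *: (x - p) - p) = 1.
  have -> : x + ((1 - r) / r) *: (x - p) - p = r^-1 *: (x - p) by row_ring.
  by rewrite normZ_ge0 ?invr_ge0 ?ltW// xp mulVf.
split=> //; apply/supporting_sphere_mball => //; first exact: ltW.
exists (x + ((1 - r) / r) *: (x - p)); split=> //.
  by rewrite addrAC subrr add0r normZ_ge0// xp divfK.
by exists p; split; rewrite // /closed_ball_ /= xp.
Qed.

(** * Rotundity *)

(** Strict convexity of the norm in midpoint form, free of any topology.  The
inequalities force the whole segment to have norm [1], see [flat_segment]. *)
Definition rotund := forall m d, N (m + d) <= 1 -> N (m - d) <= 1 ->
  1 <= N m -> d = 0.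

(** The points with parameters [s] and [- s] have norm at most [1] and average
to [m], so both must have norm [1]. *)
Lemma flat_segment m d s : N (m + d) <= 1 -> N (m - d) <= 1 -> 1 <= N m ->
  `|s| <= 1 -> N (m + s *: d) = 1.
Proof.
move=> md1 md2 m1 s1.
have le1 c : `|c| <= 1 -> N (m + c *: d) <= 1.
  rewrite ler_norml => /andP[c0 c1].
  have := @mball_conv 0 1 (m - d) (m + d) ((1 + c) / 2).
  rewrite /closed_ball_ /= !sub0r !normN => H.
  have -> : m + c *: d =
    (1 - (1 + c) / 2) *: (m - d) + ((1 + c) / 2) *: (m + d) by row_ring.
  by apply: H => //; apply/andP; split; lra.
have := le1 s s1; have := le1 (- s); rewrite normrN => /(_ s1).
have := norm_triangle (m + s *: d) (m + (- s) *: d).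
have -> : m + s *: d + (m + (- s) *: d) = 2 *: m by row_ring.
by rewrite normZ_ge0//; lra.
Qed.

Lemma strictly_convex_normP : strictly_convex_norm N <-> rotund.
Proof.
have norm1 y : msphere N 0 1 y <-> N y = 1 by rewrite /msphere /= sub0r normN.
split=> [[_ _ sc] m d md1 md2 m1|rot].
  apply/eqP/negP => /negP d0; apply: (sc (m - d) (m + d)).
    apply: contra d0 => /eqP mdE; apply/eqP.
    have -> : d = 2^-1 *: ((m + d) - (m - d)) by row_ring.
    by rewrite mdE subrr scaler0.
  rewrite boundary_mball// => y [t]; rewrite /= in_itv /= => /andP[t0 t1] <-.
  apply/norm1.
  have -> : (1 - t) *: (m - d) + t *: (m + d) = m + (2 * t - 1) *: d.
    by row_ring.
  by apply: flat_segment => //; rewrite ler_norml; apply/andP; split; lra.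
split; [exact: closed_mball| |move=> x1 x2 x12].
  by apply: convex_set_segment => p q t; exact: mball_conv.
rewrite boundary_mball// => seg; move/eqP: x12; apply.
have H t : 0 <= t -> t <= 1 -> N ((1 - t) *: x1 + t *: x2) = 1.
  by move=> t0 t1; apply/norm1; apply: seg; exists t; rewrite //= in_itv /= t0.
have d0 : 2^-1 *: (x2 - x1) = 0.
  apply: (rot (2^-1 *: (x1 + x2))).
  - have -> : 2^-1 *: (x1 + x2) + 2^-1 *: (x2 - x1) = (1 - 1) *: x1 + 1 *: x2.
      by row_ring.
    by rewrite H.
  - have -> : 2^-1 *: (x1 + x2) - 2^-1 *: (x2 - x1) = (1 - 0) *: x1 + 0 *: x2.
      by row_ring.
    by rewrite H.
  - have -> : 2^-1 *: (x1 + x2) = (1 - 2^-1) *: x1 + 2^-1 *: x2 by row_ring.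
    by rewrite H//; lra.
have -> : x1 = x2 - 2 *: (2^-1 *: (x2 - x1)) by row_ring.
by rewrite d0 scaler0 subr0.
Qed.

(** The equality case of the triangle inequality for a sum of norm [1]:
[u] and [v] are positively proportional.  Writing [u = r *: u1] and
[v = (1 - r) *: v1], the sum is strictly between [v1] and [u1] in the unit ball,
hence the midpoint of a shorter segment of the same direction. *)
Lemma rotund_triangle u v r : rotund -> 0 < r < 1 ->
  N u <= r -> N v <= 1 - r -> 1 <= N (u + v) -> (1 - r) *: u = r *: v.
Proof.
move=> rot /andP[r0 r1] ur vr uv.
have r0' : r != 0 by rewrite gt_eqF.
have r1' : 1 - r != 0 by rewrite gt_eqF// subr_gt0.
(* The largest half-length, in units of [u1 - v1], that stays inside. *)
pose e := Num.min r (1 - r).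
have e0 : 0 < e by rewrite lt_min r0 subr_gt0.
have er : e <= r by rewrite ge_min lexx.
have er' : e <= 1 - r by rewrite ge_min lexx orbT.
have le1 a b : 0 <= a -> 0 <= b -> a * r + b * (1 - r) = 1 ->
    N (a *: u + b *: v) <= 1.
  move=> a0 b0 <-; apply: le_trans (norm_triangle _ _) _.
  by rewrite !normZ_ge0// lerD// ler_wpM2l.
have d0 : (e / r) *: u - (e / (1 - r)) *: v = 0.
  apply: (rot (u + v)) => //.
  - have -> : u + v + ((e / r) *: u - (e / (1 - r)) *: v) =
      (1 + e / r) *: u + (1 - e / (1 - r)) *: v by row_ring.
    apply: le1; last by field; rewrite r0' r1'.
      by rewrite addr_ge0// divr_ge0 ?ltW.
    by rewrite subr_ge0 ler_pdivrMr ?mul1r// subr_gt0.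
  - have -> : u + v - ((e / r) *: u - (e / (1 - r)) *: v) =
      (1 - e / r) *: u + (1 + e / (1 - r)) *: v by row_ring.
    apply: le1; last by field; rewrite r0' r1'.
      by rewrite subr_ge0 ler_pdivrMr ?mul1r.
    by rewrite addr_ge0// divr_ge0 ?subr_ge0 ?ltW.
have e0' : e != 0 by rewrite gt_eqF.
apply/eqP; rewrite -subr_eq0; apply/eqP.
have -> : (1 - r) *: u - r *: v =
    (r * (1 - r) / e) *: ((e / r) *: u - (e / (1 - r)) *: v) by row_ring.
by rewrite d0 scaler0.
Qed.

(** All the centers are at distance less than [1] from the midpoint, uniformly
by compactness; the slack is the radius of a ball around the midpoint that
lies in every unit ball containing [K]. *)
Lemma rotund_midpoint_interior K p q : rotund -> b_convex N K ->
  K p -> K q -> p != q -> K° (2^-1 *: (p + q)).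
Proof.
move=> rot Kb Kp Kq pq.
have [||y Ky|r [r0 r1 Cr]] :=
  @uniform_strict_dist (centers K) (2^-1 *: (p + q)).
- exact: closed_centers.
- by apply: mbounded_centers; exists p.
- rewrite ltNge; apply/negP => my; move/eqP: pq; apply.
  have d0 : 2^-1 *: (p - q) = 0.
    apply: (rot (y - 2^-1 *: (p + q))); last by rewrite normBC.
    + have -> : y - 2^-1 *: (p + q) + 2^-1 *: (p - q) = y - q by row_ring.
      exact: Ky.
    + have -> : y - 2^-1 *: (p + q) - 2^-1 *: (p - q) = y - p by row_ring.
      exact: Ky.
  have -> : p = q + 2 *: (2^-1 *: (p - q)) by row_ring.
  by rewrite d0 scaler0 addr0.
apply/interior_ballP; exists (1 - r); first by rewrite subr_gt0.
move=> z mz; rewrite Kb => y Ky; rewrite /closed_ball_ /=.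
have := Cr y Ky; move: mz; rewrite /closed_ball_ /= (normBC _ y).
by have := normB_triangle (2^-1 *: (p + q)) y z; lra.
Qed.

(** The midpoint of a segment in the boundary would be interior. *)
Lemma rotund_strictly_convex K :
  rotund -> b_convex N K -> strictly_convex_set K.
Proof.
move=> rot Kb; split; first exact: b_convex_closed.
  by rewrite Kb; exact: convex_ball_hull.
move=> p q pq seg.
have K_bd t : 0 <= t <= 1 -> boundary K ((1 - t) *: p + t *: q).
  by move=> t01; apply: seg; exists t; rewrite //= in_itv.
have bdK : boundary K `<=` K.
  by rewrite /boundary -(closure_id _).1; [move=> ? []|exact: b_convex_closed].
have [|_] := K_bd 2^-1; first by apply/andP; split; lra.
have -> : (1 - 2^-1) *: p + 2^-1 *: q = 2^-1 *: (p + q) by row_ring.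
apply; apply: rotund_midpoint_interior => //; apply: bdK.
- by have := K_bd 0; rewrite lexx ler01 subr0 scale1r scale0r addr0; exact.
- by have := K_bd 1; rewrite lexx ler01 subrr scale1r scale0r add0r; exact.
Qed.

(** In terms of a norming functional [f] of [m], the hull lies in [f <= 1] and
in [2 - f <= 1], so in a hyperplane.  Without [f]: an interior point [p] could
be moved by [e *: m] up and down, and the two bounds add up to
[2 * (1 + e) <= 2]. *)
Lemma flat_hull_interior m d : N (m + d) <= 1 -> N (m - d) <= 1 -> 1 <= N m ->
  (ball_hull N [set m - d; m + d])° = set0.
Proof.
move=> md1 md2 m1; apply/seteqP; split=> // p /interior_ballP[e e0 pe].
have sub0 : ball_hull N [set m - d; m + d] `<=` closed_ball_ N 0 1.
  apply: ball_hull_sub => _ [->|->]; rewrite /closed_ball_ /= sub0r normN//.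
have sub2 : ball_hull N [set m - d; m + d] `<=` closed_ball_ N (2 *: m) 1.
  apply: ball_hull_sub => _ [->|->]; rewrite /closed_ball_ /=.
    by have -> : 2 *: m - (m - d) = m + d by row_ring.
  by have -> : 2 *: m - (m + d) = m - d by row_ring.
have Nm : N m = 1.
  by rewrite -[m]addr0 -(scale0r d); apply: flat_segment; rewrite ?normr0.
have /pe/sub0 : closed_ball_ N p e (p + e *: m).
  rewrite /closed_ball_ /= opprD addrA subrr sub0r normN normZ_ge0 ?(ltW e0)//.
  by rewrite Nm mulr1.
have /pe/sub2 : closed_ball_ N p e (p - e *: m).
  rewrite /closed_ball_ /= opprB addrCA subrr addr0 normZ_ge0 ?(ltW e0)//.
  by rewrite Nm mulr1.
rewrite /closed_ball_ /= sub0r normN.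
have := norm_triangle (2 *: m - (p - e *: m)) (p + e *: m).
have -> : 2 *: m - (p - e *: m) + (p + e *: m) = (2 * (1 + e)) *: m by row_ring.
by rewrite normZ_ge0 ?Nm; lra.
Qed.

(** * Bodies of circumradius one *)

(** Two distinct centers would make the ball around their midpoint contain [K]
with a radius less than [1]. *)
Lemma rotund_unbounded_mball K : (0 < n)%N -> rotund -> b_convex_body N K ->
  ~ b_bounded N K -> exists x, K = closed_ball_ N x 1.
Proof.
move=> n0 rot [Kb _ Km] Knb; have [x Kx] := centers_nonempty n0 Kb Km.
exists x; apply: b_convex_center_unique => // y Ky.
apply: contrapT => yx; apply: Knb; apply/b_boundedP.
exists (2^-1 *: (x + y)); apply: uniform_strict_dist => //.
  exact: b_convex_closed.
move=> p Kp; rewrite ltNge; apply/negP => mp; apply: yx.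
have d0 : 2^-1 *: (y - x) = 0.
  apply: (rot (2^-1 *: (x + y) - p)) => //.
  - have -> : 2^-1 *: (x + y) - p + 2^-1 *: (y - x) = y - p by row_ring.
    exact: Ky.
  - have -> : 2^-1 *: (x + y) - p - 2^-1 *: (y - x) = x - p by row_ring.
    exact: Kx.
have -> : y = x + 2 *: (2^-1 *: (y - x)) by row_ring.
by rewrite d0 scaler0 addr0.
Qed.

Lemma unit_mball_unique_supporting_sphere x : (0 < n)%N ->
  exists! T, supporting_sphere N (closed_ball_ N x 1) T.
Proof.
move=> n0; exists (msphere N x 1); split.
  have [p xp _] := far_point n0 x x ler01.
  by exists x; split=> //; exists p; split; rewrite // /closed_ball_ /= xp.
move=> T [y [-> /(sub_closed_ball n0 _ _ _ ler01) yx _]].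
suff : y - x = 0 by move/subr0_eq => ->.
by apply/eqP; rewrite -norm_eq0 eq_le norm_ge0 andbT; move: yx; lra.
Qed.

(** For a body that is not b-bounded every center yields a supporting sphere,
and a sphere determines its center: there is one center only. *)
Lemma unique_supporting_sphere_mball K : (0 < n)%N -> b_convex_body N K ->
  ~ b_bounded N K -> (exists! T, supporting_sphere N K T) ->
  exists x, K = closed_ball_ N x 1.
Proof.
move=> n0 [Kb _ Km] Knb [T [_ TU]]; have [x Kx] := centers_nonempty n0 Kb Km.
exists x; apply: b_convex_center_unique => // y Ky.
apply: (msphere_inj n0 ler01).
rewrite -(TU (msphere N x 1)) ?(TU (msphere N y 1))//;
  exact: supporting_sphere_unbounded.
Qed.

(** A flat segment makes the lens [K] between the unit balls with centers [d]
and [- d] as wide as a unit ball, with width [2] from [- m] to [m], although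
both bounding spheres pass through [m]. *)
Lemma rotund_of_unique_sphere_unbounded : (0 < n)%N ->
  (forall K, b_convex_body N K -> ~ b_bounded N K ->
    forall x, boundary K x -> exists! T, supporting_sphere N K T /\ T x) ->
  rotund.
Proof.
move=> n0 H m d md1 md2 m1.
have Nmd1 : N (m + d) = 1.
  by rewrite -[d]scale1r; apply: flat_segment; rewrite ?normr1.
have Nmd2 : N (m - d) = 1.
  by rewrite -scaleN1r; apply: flat_segment; rewrite ?normrN1.
pose K := \bigcap_(x in [set d; - d]) closed_ball_ N x 1.
have Kd : K `<=` closed_ball_ N d 1 by move=> p; apply; left.
have KNd : K `<=` closed_ball_ N (- d) 1 by move=> p; apply; right.
have dm : N (d - m) = 1 by rewrite normBC.
have Ndm : N (- d - m) = 1 by rewrite -opprD normN addrC.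
have Km : K m by move=> _ [] ->; rewrite /closed_ball_ /= ?dm ?Ndm.
have KNm : K (- m).
  by move=> _ [] ->; rewrite /closed_ball_ /= opprK addrC ?Nmd1 ?Nmd2.
have Kbody : b_convex_body N K.
  split; [exact: b_convex_bigI|by exists m|].
  exact: sub_mbounded Kd (mball_mbounded _ _).
have Knb : ~ b_bounded N K.
  move=> /b_boundedP[x [r [_ r1 Kx]]].
  have := Kx _ Km; have := Kx _ KNm; rewrite /closed_ball_ /= (normBC x m).
  have := normB_triangle x m (- m).
  have -> : m - - m = 2 *: m by row_ring.
  by rewrite normZ_ge0//; lra.
have Kbd : boundary K m.
  split; first exact: subset_closure.
  move=> /(interiorS Kd); rewrite interior_mball// dm ltxx//.
have [T [_ TU]] := H K Kbody Knb m Kbd.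
have E : d = - d.
  apply: (msphere_inj n0 ler01).
  by rewrite -(TU (msphere N d 1)) ?(TU (msphere N (- d) 1))//; split => //;
    [exists (- d)|exists d]; split=> //; exists m.
have -> : d = 2^-1 *: (d - - d) by row_ring.
by rewrite -E subrr scaler0.
Qed.

(** * Balls of radius less than one *)

(** A supporting sphere of [B(x, r)] can only touch its boundary. *)
Lemma dist_center_supporting x r y p : N (y - x) <= 1 - r ->
  closed_ball_ N x r p -> msphere N y 1 p -> N (x - p) = r.
Proof.
rewrite /closed_ball_ /msphere /= => yx xp yp.
by have := normB_triangle x y p; lra.
Qed.

(** The contact point [p] lies on the line through the two centers, so [p] and
[y] determine each other. *)
Lemma rotund_supporting_parallel x r y p : rotund -> 0 < r < 1 ->
  N (y - x) <= 1 - r -> closed_ball_ N x r p -> msphere N y 1 p ->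
  (1 - r) *: (x - p) = r *: (y - x).
Proof.
move=> rot r01 yx xp yp; apply: rotund_triangle => //.
by rewrite addrC addrA subrK yp.
Qed.

Lemma rotund_unique_sphere_mball x r p : (0 < n)%N -> rotund -> 0 < r < 1 ->
  msphere N x r p ->
  exists! T, supporting_sphere N (closed_ball_ N x r) T /\ T p.
Proof.
move=> n0 rot r01 xp; exists (msphere N (tangent_center x r p) 1).
split; first exact: tangent_sphere.
have [r0 r1] := andP r01.
move=> T [/(supporting_sphere_mball _ _ n0 (ltW r0))[y [-> yx _]] yp].
have xpr : closed_ball_ N x r p by rewrite /closed_ball_ /= xp.
congr msphere; have := rotund_supporting_parallel rot r01 yx xpr yp.
have rn0 : r != 0 by rewrite gt_eqF.
rewrite /tangent_center mulrC -scalerA => ->.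
by rewrite scalerA mulVf// scale1r addrC subrK.
Qed.

Lemma rotund_singleton_face x r T : (0 < n)%N -> rotund -> 0 < r < 1 ->
  supporting_sphere N (closed_ball_ N x r) T ->
  exists p, closed_ball_ N x r `&` T = [set p].
Proof.
move=> n0 rot r01; have [r0 r1] := andP r01.
move=> /(supporting_sphere_mball _ _ n0 (ltW r0))[y [-> yx [p [xp yp]]]].
exists p; apply/seteqP; split=> [q [xq yq]|q ->] //=.
have := rotund_supporting_parallel rot r01 yx xp yp.
rewrite -(rotund_supporting_parallel rot r01 yx xq yq).
move/scalerI; rewrite subr_eq0 eq_sym lt_eqF// => /(_ isT).
by move/addrI/oppr_inj.
Qed.

Lemma rotund_b_exp_mball x r : (0 < n)%N -> rotund -> 0 < r < 1 ->
  b_exp N (closed_ball_ N x r) = msphere N x r.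
Proof.
move=> n0 rot r01; have [r0 r1] := andP r01.
apply/seteqP; split=> p.
  move=> [_ /(supporting_sphere_mball _ _ n0 (ltW r0))[y [-> yx _]]].
  move=> pE.
  have [xp yp] : (closed_ball_ N x r `&` msphere N y 1) p by rewrite -pE.
  exact: dist_center_supporting yx xp yp.
move=> xp; have [Ts Tp] := tangent_sphere n0 r01 xp.
exists (msphere N (tangent_center x r p) 1) => //.
have [q qE] := rotund_singleton_face n0 rot r01 Ts.
have : (closed_ball_ N x r `&` msphere N (tangent_center x r p) 1) p.
  by split; rewrite // /closed_ball_ /= xp.
by rewrite qE => ->.
Qed.

(** A flat segment gives a family of unit balls around [B(x, r)], all of them
touching it along the same segment: the difference of a center and a contact
point is a convex combination of points of the flat segment. *)
Lemma flat_supporting m d x r s t : (0 < n)%N -> 0 < r < 1 ->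
  N (m + d) <= 1 -> N (m - d) <= 1 -> 1 <= N m ->
  0 <= s <= 1 -> 0 <= t <= 1 ->
  [/\ supporting_sphere N (closed_ball_ N x r)
        (msphere N (x + (1 - r) *: (m + s *: d)) 1),
      msphere N x r (x - r *: (m + t *: d)) &
      msphere N (x + (1 - r) *: (m + s *: d)) 1 (x - r *: (m + t *: d))].
Proof.
move=> n0 /andP[r_gt0 r1] md1 md2 m1; have r_lt1 : 0 < 1 - r by lra.
move=> /andP[s0 s1] /andP[t0 t1].
have flat c : 0 <= c -> c <= 1 -> N (m + c *: d) = 1.
  by move=> c0 c1; apply: flat_segment => //; rewrite ger0_norm.
have xp : msphere N x r (x - r *: (m + t *: d)).
  rewrite /msphere /= opprB addrCA subrr addr0 normZ_ge0 ?(ltW r_gt0)//.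
  by rewrite flat// mulr1.
have yp : msphere N (x + (1 - r) *: (m + s *: d)) 1 (x - r *: (m + t *: d)).
  rewrite /msphere /=.
  have -> : x + (1 - r) *: (m + s *: d) - (x - r *: (m + t *: d)) =
    m + ((1 - r) * s + r * t) *: d by row_ring.
  have rs : 0 <= (1 - r) * s by rewrite mulr_ge0 ?(ltW r_lt1).
  have rt : 0 <= r * t by rewrite mulr_ge0 ?(ltW r_gt0).
  apply: flat; first exact: addr_ge0.
  have rs' : (1 - r) * s <= 1 - r by rewrite ler_piMr ?(ltW r_lt1).
  have rt' : r * t <= r by rewrite ler_piMr ?(ltW r_gt0).
  by lra.
split=> //; apply/(supporting_sphere_mball _ _ n0 (ltW r_gt0)).
exists (x + (1 - r) *: (m + s *: d)); split=> //.
  rewrite addrAC subrr add0r normZ_ge0 ?(ltW r_lt1)// flat// mulr1//.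
by exists (x - r *: (m + t *: d)); split; rewrite // /closed_ball_ /= xp.
Qed.

(** The supporting spheres with parameters [s = 0] and [s = 1] share the contact
point with [t = 0]. *)
Lemma rotund_of_unique_sphere_mball x r : (0 < n)%N -> 0 < r < 1 ->
  (forall p, msphere N x r p ->
    exists! T, supporting_sphere N (closed_ball_ N x r) T /\ T p) ->
  rotund.
Proof.
move=> n0 r01 H m d md1 md2 m1; have [r0 r1] := andP r01.
have i0 : 0 <= (0 : R) <= 1 by rewrite lexx ler01.
have i1 : 0 <= (1 : R) <= 1 by rewrite lexx ler01.
have [T0 xp T0p] := flat_supporting x n0 r01 md1 md2 m1 i0 i0.
have [T1 _ T1p] := flat_supporting x n0 r01 md1 md2 m1 i1 i0.
have [T [_ TU]] := H _ xp.
have := TU _ (conj T0 T0p); rewrite (TU _ (conj T1 T1p)).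
move/(msphere_inj n0 ler01)/addrI/scalerI.
rewrite subr_eq0 gt_eqF// => /(_ isT).
by move/addrI; rewrite scale1r scale0r.
Qed.

(** The supporting sphere with [s = 0] has the contact points with [t = 0] and
[t = 1]. *)
Lemma rotund_of_singleton_face x r : (0 < n)%N -> 0 < r < 1 ->
  (forall T, supporting_sphere N (closed_ball_ N x r) T ->
    exists p, closed_ball_ N x r `&` T = [set p]) ->
  rotund.
Proof.
move=> n0 r01 H m d md1 md2 m1; have [r0 r1] := andP r01.
have i0 : 0 <= (0 : R) <= 1 by rewrite lexx ler01.
have i1 : 0 <= (1 : R) <= 1 by rewrite lexx ler01.
have [T0 xp p0] := flat_supporting x n0 r01 md1 md2 m1 i0 i0.
have [_ xq q0] := flat_supporting x n0 r01 md1 md2 m1 i0 i1.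
have [z zE] := H _ T0.
have zP p : msphere N x r p ->
    msphere N (x + (1 - r) *: (m + 0 *: d)) 1 p -> p = z.
  move=> xpr yp.
  suff : (closed_ball_ N x r `&` msphere N (x + (1 - r) *: (m + 0 *: d)) 1) p.
    by rewrite zE.
  by split; rewrite // /closed_ball_ /= xpr.
have := zP _ xq q0; rewrite -(zP _ xp p0).
move/addrI/oppr_inj/scalerI; rewrite gt_eqF// => /(_ isT)/addrI.
by rewrite scale1r scale0r.
Qed.

(** Here the supporting sphere exposing the midpoint [x - r *: m] of a flat
segment of [B(x, r)] is arbitrary, but any such sphere contains the whole
segment, which is in the unit ball and has its midpoint on the sphere. *)
Lemma rotund_of_b_exp_mball x r : (0 < n)%N -> 0 < r < 1 ->
  b_exp N (closed_ball_ N x r) = msphere N x r -> rotund.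
Proof.
move=> n0 r01 H m d md1 md2 m1; have [r0 r1] := andP r01.
have flat s : `|s| <= 1 -> N (m + s *: d) = 1 by exact: flat_segment.
have ballP s : `|s| <= 1 -> closed_ball_ N x r (x - r *: (m + s *: d)).
  move=> s1; rewrite /closed_ball_ /= opprB addrCA subrr addr0.
  by rewrite normZ_ge0 ?(ltW r0)// flat// mulr1.
have : msphere N x r (x - r *: m).
  rewrite /msphere /= opprB addrCA subrr addr0 normZ_ge0 ?(ltW r0)//.
  by rewrite -[m]addr0 -(scale0r d) flat ?normr0// mulr1.
rewrite -H => -[_ /(supporting_sphere_mball _ _ n0 (ltW r0))[y [-> yx _]] pE].
have [xp yp] : (closed_ball_ N x r `&` msphere N y 1) (x - r *: m).
  by rewrite -pE.
have yle s : `|s| <= 1 -> N (y - (x - r *: m) + s *: (r *: d)) <= 1.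
  move=> s1.
  have -> : y - (x - r *: m) + s *: (r *: d) = y - (x - r *: (m + s *: d)).
    by row_ring.
  apply: le_trans (normB_triangle x _ _) _.
  by have := ballP s s1; rewrite /closed_ball_ /=; lra.
have n1 : `|1| <= 1 :> R by rewrite normr1.
have nN1 : `|-1| <= 1 :> R by rewrite normrN1.
have : [set x - r *: m] (x - r *: (m + 1 *: d)).
  rewrite pE; split; first exact: ballP.
  have -> : x - r *: (m + 1 *: d) = x - r *: m - r *: d by row_ring.
  rewrite /msphere /= opprB addrCA [X in N X]addrC -[r *: d]scale1r.
  apply: flat_segment; last exact: n1.
  - by have := yle 1 n1; rewrite scale1r.
  - by have := yle (-1) nN1; rewrite scaleN1r.
  - by rewrite yp.
move/addrI/oppr_inj/scalerI; rewrite gt_eqF// => /(_ isT).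
by rewrite scale1r -[RHS]addr0 => /addrI.
Qed.

(** * Hulls of two points *)

(** Restricting to hulls that are b-convex bodies, which excludes points too far
apart to fit in a unit ball, lets statements on bodies use this lemma. *)
Lemma rotund_of_pair_hull_interior :
  (forall x1 x2, x1 != x2 -> b_convex_body N (ball_hull N [set x1; x2]) ->
    (ball_hull N [set x1; x2])° !=set0) -> rotund.
Proof.
move=> H m d md1 md2 m1; apply: contrapT => d0.
have sub0 : [set m - d; m + d] `<=` closed_ball_ N 0 1.
  by move=> _ [->|->]; rewrite /closed_ball_ /= sub0r normN.
have [||p] := H (m - d) (m + d); last by rewrite flat_hull_interior.
  apply/eqP => /addrI E; apply: d0.
  have -> : d = 2^-1 *: (d - - d) by row_ring.
  by rewrite E subrr scaler0.
split; first exact: b_convex_ball_hull.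
  by exists (m - d); apply: sub_ball_hull; left.
exact: sub_mbounded (ball_hull_sub sub0) (mball_mbounded _ _).
Qed.

(** A closed convex set with empty interior is its own boundary, which would
contain the segment from [x1] to [x2]. *)
Lemma pair_hull_interior x1 x2 :
  strictly_convex_set (ball_hull N [set x1; x2]) -> x1 != x2 ->
  (ball_hull N [set x1; x2])° !=set0.
Proof.
move=> [hcl _ sc] x12; apply: contrapT => int0; apply: (sc _ _ x12).
move=> p [t]; rewrite /= in_itv /= => t01 <-; split.
  apply/subset_closure/ball_hull_conv => //.
    by apply: sub_ball_hull; left.
  by apply: sub_ball_hull; right.
by move=> pint; apply: int0; exists ((1 - t) *: x1 + t *: x2).
Qed.

End NormTheory.

Theorem proposition2 (R : realType) (n : nat) (N : 'rV[R]_n -> R)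
    (n_gt0 : (0 < n)%N) (N_norm : is_norm N) :
  [<->
    (* (i) *)
    strictly_convex_norm N;
    (* (vi) *)
    forall K, b_convex_body N K -> ~ b_bounded N K ->
      exists x, K = closed_ball_ N x 1;
    (* (vii) *)
    forall K, b_convex_body N K -> ~ b_bounded N K ->
      exists! T, supporting_sphere N K T;
    (* (viii) *)
    forall K, b_convex_body N K -> ~ b_bounded N K ->
      forall x, boundary K x -> exists! T, supporting_sphere N K T /\ T x;
    (* (ix) *)
    forall x (r : R), 0 < r < 1 ->
      forall x0, boundary (closed_ball_ N x r) x0 ->
        exists! T, supporting_sphere N (closed_ball_ N x r) T /\ T x0;
    (* (x) *)
    exists x (r : R), 0 < r < 1 /\
      forall x0, boundary (closed_ball_ N x r) x0 ->
        exists! T, supporting_sphere N (closed_ball_ N x r) T /\ T x0;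
    (* (xi) *)
    forall x (r : R), 0 < r < 1 ->
      forall T, supporting_sphere N (closed_ball_ N x r) T ->
        exists y, closed_ball_ N x r `&` T = [set y];
    (* (xii) *)
    exists x (r : R), 0 < r < 1 /\
      forall T, supporting_sphere N (closed_ball_ N x r) T ->
        exists y, closed_ball_ N x r `&` T = [set y];
    (* (xiii) *)
    forall x (r : R), 0 < r < 1 ->
      b_exp N (closed_ball_ N x r) = msphere N x r;
    (* (xiv) *)
    exists x (r : R), 0 < r < 1 /\
      b_exp N (closed_ball_ N x r) = msphere N x r;
    (* (xv) *)
    forall K, b_convex_body N K -> strictly_convex_set K;
    (* (xvi) *)
    forall x1 x2 : 'rV[R]_n, x1 != x2 ->
      strictly_convex_set (ball_hull N [set x1; x2]);
    (* (xvii) *)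
    forall K, b_convex_body N K ->
      (exists x1 x2, [/\ K x1, K x2 & x1 != x2]) -> K° !=set0;
    (* (xviii) *)
    forall x1 x2 : 'rV[R]_n, x1 != x2 ->
      (ball_hull N [set x1; x2])° !=set0 ].

Proof.
have rotP := strictly_convex_normP N_norm.
have half01 : 0 < (2^-1 : R) < 1 by apply/andP; split; lra.
tfae.
- move=> /rotP rot K; exact: rotund_unbounded_mball.
- move=> H K Kb Knb; have [x ->] := H K Kb Knb.
  exact: unit_mball_unique_supporting_sphere.
- move=> H K Kb Knb p; have KT := H K Kb Knb.
  have [x KE] := unique_supporting_sphere_mball N_norm n_gt0 Kb Knb KT.
  move: KT; rewrite KE boundary_mball// => -[T [Ts TU]] xp; exists T; split.
    split=> //; suff <- : msphere N x 1 = T by [].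
    apply/esym/TU; exists x; split=> //; exists p.
    by split; rewrite // /closed_ball_ /= xp.
  by move=> T' [/TU].
- move=> /(rotund_of_unique_sphere_unbounded N_norm n_gt0) rot x r r01 p.
  have [r0 _] := andP r01; rewrite boundary_mball//.
  exact: rotund_unique_sphere_mball.
- by move=> H; exists 0, 2^-1; split=> //; exact: (H _ _ half01).
- move=> [x [r [r01]]]; have [r0 _] := andP r01; rewrite boundary_mball// => H.
  have rot := rotund_of_unique_sphere_mball N_norm n_gt0 r01 H.
  by move=> {r01 H}x {r0}r r01 T; exact: rotund_singleton_face.
- by move=> H; exists 0, 2^-1; split=> //; exact: (H _ _ half01).
- move=> [x [r [r01]]] /(rotund_of_singleton_face N_norm n_gt0 r01) rot.
  move=> {r01}x {}r r01.
  exact: rotund_b_exp_mball.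
- by move=> H; exists 0, 2^-1; split=> //; exact: (H _ _ half01).
- move=> [x [r [r01]]] /(rotund_of_b_exp_mball N_norm n_gt0 r01) rot K [Kb _ _].
  exact: (rotund_strictly_convex N_norm).
- move=> H x1 x2 _; apply: (rotund_strictly_convex N_norm) => //; last first.
    exact: b_convex_ball_hull.
  apply: rotund_of_pair_hull_interior => // y1 y2 y12 Kbody.
  by apply: pair_hull_interior => //; exact: H.
- move=> H; have rot : rotund N.
    apply: rotund_of_pair_hull_interior => // x1 x2 x12 _.
    by apply: pair_hull_interior => //; exact: H.
  move=> K [Kb _ _] [p [q [Kp Kq pq]]]; exists (2^-1 *: (p + q)).
  exact: (rotund_midpoint_interior N_norm).
- move=> H x1 x2 x12; have rot : rotund N.
    apply: rotund_of_pair_hull_interior => // y1 y2 y12 Kbody; apply: H => //.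
    by exists y1, y2; split=> //; apply: sub_ball_hull; [left|right].
  exists (2^-1 *: (x1 + x2)); apply: (rotund_midpoint_interior N_norm) => //.
  + exact: b_convex_ball_hull.
  + by apply: sub_ball_hull; left.
  + by apply: sub_ball_hull; right.
- move=> H; apply/rotP/rotund_of_pair_hull_interior => // x1 x2 x12 _.
  exact: H.
Qed.
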